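(* Let $\alpha,\beta,\gamma,g\in\mathbb{R}$. The Riccati equation $$\dot p(t)+\alpha p(t)+\beta p(t)^2+\gamma=0,\quad t\in[0,T],\qquad p(T)=g,$$ admits a solution on $[0,T]$ for every $T>0$ if and only if $$\alpha^2-4\beta\gamma\ge0\quad\text{and}\quad2\beta g+\alpha-\sqrt{\alpha^2-4\beta\gamma}\le0.$$
   Context: The unknown $p(\cdot)$ is real-valued, and a solution on $[0,T]$ means a differentiable function $p:[0,T]\to\mathbb{R}$ satisfying the equation on $[0,T]$ and the terminal condition. *)

(* Defs.v *)
From Stdlib Require Import Reals.
Local Open Scope R_scope.

(* Functions on [0, T] are encoded as total functions R -> R whose values
   outside [0, T] are irrelevant: [D_in p dp D t] takes the derivative of p at t
   relative to D, hence the one-sided derivative at t = 0 and t = T. *)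
Definition riccati_solution (alpha beta gamma g T : R) (p : R -> R) : Prop :=
  (exists dp : R -> R,
     forall t : R, 0 <= t <= T ->
       D_in p dp (fun s => 0 <= s <= T) t /\
       dp t + alpha * p t + beta * p t ^ 2 + gamma = 0) /\
  p T = g.

(* Main.v *)
Require Import Defs.
From Stdlib Require Import Reals.
From Stdlib Require Import Lra.
From Coquelicot Require Import Coquelicot.
Local Open Scope R_scope.

(** With [w = 2 beta p + alpha] and [Delta = alpha^2 - 4 beta gamma] the equation
    becomes [w' = (Delta - w^2) / 2], and in the backward time [s = T - t] it is
    the projectivization [p = N / D] of the linear system
    [N' = alpha/2 N + gamma D], [D' = - beta N - alpha/2 D], whose matrix squares
    to [Delta/4].  If the two conditions hold, the denominator [D] stays positive
    for [s >= 0].  If [Delta < 0], then [atan (w / sqrt (-Delta))] has constant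
    nonzero slope, which bounds [T].  If [w(T) > sqrt Delta], then
    [h = w - sqrt Delta] stays bounded below by a positive constant backward in
    time, so [1 / h] has slope at least [1/2], which again bounds [T]. *)

(** * Calculus tools and one-sided derivatives *)

Lemma derive_lower_bound (f f' : R -> R) (c a b : R) :
  a < b ->
  (forall x, a <= x <= b -> is_derive f x (f' x)) ->
  (forall x, a <= x <= b -> c <= f' x) ->
  c * (b - a) <= f b - f a.
Proof.
  intros Hab Hd Hc.
  destruct (MVT_cor2 f f' a b Hab) as [x [-> Hx]].
  - intros x Hx; apply is_derive_Reals, Hd, Hx.
  - apply Rmult_le_compat_r; [lra | apply Hc; lra].
Qed.

(** Squaring smooths the kink at 0: the first-order remainder is at most [h ^ 2]. This makes a
    truncated barrier differentiable. *)
Lemma is_derive_pos_part_sqr (x : R) :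
  is_derive (fun y => Rmax 0 y ^ 2) x (2 * Rmax 0 x).
Proof.
  apply is_derive_Reals; intros eps Heps.
  exists (mkposreal eps Heps); intros h Hh0 Hh; simpl in Hh.
  assert (Hq : Rabs (Rmax 0 (x + h) ^ 2 - Rmax 0 x ^ 2 - 2 * Rmax 0 x * h)
               <= h ^ 2).
  { apply Rabs_le; unfold Rmax.
    destruct (Rle_dec 0 (x + h)), (Rle_dec 0 x); nra. }
  replace ((Rmax 0 (x + h) ^ 2 - Rmax 0 x ^ 2) / h - 2 * Rmax 0 x)
    with ((Rmax 0 (x + h) ^ 2 - Rmax 0 x ^ 2 - 2 * Rmax 0 x * h) / h)
    by (field; exact Hh0).
  unfold Rdiv; rewrite Rabs_mult, Rabs_inv.
  apply Rle_lt_trans with (2 := Hh).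
  assert (0 < Rabs h) by (apply Rabs_pos_lt; exact Hh0).
  apply Rmult_le_reg_r with (Rabs h); [assumption|].
  rewrite Rmult_assoc, Rinv_l, Rmult_1_r by lra.
  apply Rle_trans with (1 := Hq).
  rewrite <- Rabs_mult, Rabs_pos_eq; nra.
Qed.

Lemma D_in_interior (f df : R -> R) (a b x : R) :
  a < x < b -> D_in f df (fun s => a <= s <= b) x -> is_derive f x (df x).
Proof.
  intros Hx Hf; apply is_derive_Reals, derivable_pt_lim_D_in.
  intros eps Heps; destruct (Hf eps Heps) as [r [Hr Hlim]].
  exists (Rmin r (Rmin (x - a) (b - x))); split.
  - repeat apply Rmin_pos; lra.
  - intros y [[_ Hxy] Hy]; apply Hlim.
    simpl in *; unfold Rdist in *.
    pose proof (Rmin_l r (Rmin (x - a) (b - x))).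
    pose proof (Rmin_r r (Rmin (x - a) (b - x))).
    pose proof (Rmin_l (x - a) (b - x)).
    pose proof (Rmin_r (x - a) (b - x)).
    destruct (Rabs_def2 _ _ Hy).
    repeat split; try assumption; lra.
Qed.

Lemma is_derive_D_in (f df : R -> R) (D : R -> Prop) (x : R) :
  is_derive f x (df x) -> D_in f df D x.
Proof.
  intros Hf; apply is_derive_Reals, derivable_pt_lim_D_in in Hf.
  apply limit1_imp with (2 := Hf).
  intros y [_ Hy]; split; [exact I | exact Hy].
Qed.

(** * Necessity: bounds on the length of existence *)

Lemma riccati_normal_form (alpha beta gamma g T : R) (p : R -> R) (t : R) :
  riccati_solution alpha beta gamma g T p -> 0 < t < T ->
  is_derive (fun t => 2 * beta * p t + alpha) t
    ((alpha ^ 2 - 4 * beta * gamma - (2 * beta * p t + alpha) ^ 2) / 2).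
Proof.
  intros [[dp Hp] _] Ht.
  destruct (Hp t) as [Hd He]; [lra|].
  apply D_in_interior in Hd; [|exact Ht].
  assert (Hex : ex_derive p t) by (exists (dp t); exact Hd).
  auto_derive; [exact Hex|].
  rewrite (is_derive_unique (fun x : R => p x) _ _ Hd).
  replace (dp t) with (- (alpha * p t + beta * p t ^ 2 + gamma)) by lra.
  field.
Qed.

(** Two-sided derivatives are available only inside [(0, T)]; continuity of [p] at [T] carries the
    strict inequality to an interior time. *)
Lemma riccati_terminal_limit (alpha beta gamma g T : R) (p : R -> R) (eta y : R) :
  riccati_solution alpha beta gamma g T p -> 0 < T -> 0 < eta ->
  y < 2 * beta * g + alpha ->
  exists t, 0 < t < T /\ T - eta < t /\ y < 2 * beta * p t + alpha.
Proof.
  intros [[dp Hp] HT] HT0 Heta Hy.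
  destruct (Hp T) as [Hd _]; [lra|].
  apply cont_deriv in Hd.
  (* [k] dominates the slope [2 * Rabs beta] of [w] in [p], and stays positive when [beta = 0]. *)
  set (k := 2 * Rabs beta + 1).
  assert (Hk : 0 < k) by (pose proof (Rabs_pos beta); unfold k; lra).
  destruct (Hd ((2 * beta * g + alpha - y) / k)) as [r [Hr Hlim]].
  { apply Rdiv_lt_0_compat; lra. }
  set (m := Rmin r (Rmin eta T)).
  assert (Hm : 0 < m) by (repeat apply Rmin_pos; lra).
  assert (m <= r /\ m <= eta /\ m <= T) as (Hmr & Hme & HmT).
  { pose proof (Rmin_l r (Rmin eta T)); pose proof (Rmin_r r (Rmin eta T)).
    pose proof (Rmin_l eta T); pose proof (Rmin_r eta T).
    unfold m; repeat split; lra. }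
  exists (T - m / 2); repeat split; try lra.
  assert (Hc : Rabs (p (T - m / 2) - g) < (2 * beta * g + alpha - y) / k).
  { simpl in Hlim; unfold Rdist in Hlim; rewrite HT in Hlim.
    apply Hlim; split; [split; lra | apply Rabs_def1; lra]. }
  apply (Rmult_lt_compat_r k) in Hc; [|exact Hk].
  unfold Rdiv in Hc; rewrite Rmult_assoc, Rinv_l, Rmult_1_r in Hc by lra.
  pose proof (Rle_abs (- (beta * (p (T - m / 2) - g)))) as Ha.
  rewrite Rabs_Ropp, Rabs_mult in Ha.
  pose proof (Rabs_pos (p (T - m / 2) - g)).
  unfold Rdiv in *; unfold k in Hc; nra.
Qed.

Lemma negative_discriminant_horizon (Delta a b : R) (w : R -> R) :
  Delta < 0 -> a < b ->
  (forall t, a <= t <= b -> is_derive w t ((Delta - w t ^ 2) / 2)) ->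
  sqrt (- Delta) / 2 * (b - a) < PI.
Proof.
  intros HD Hab Hw.
  set (om := sqrt (- Delta)).
  assert (Hom : 0 < om) by (apply sqrt_lt_R0; lra).
  assert (Hom2 : om ^ 2 = - Delta) by (apply pow2_sqrt; lra).
  assert (H : om / 2 * (b - a) <= - atan (w b / om) - - atan (w a / om)).
  { apply (derive_lower_bound (fun t => - atan (w t / om)) (fun _ => om / 2));
      [exact Hab | | intros; lra].
    intros t Ht; specialize (Hw t Ht).
    assert (Hex : ex_derive w t) by (eexists; exact Hw).
    auto_derive; [exact Hex|].
    rewrite (is_derive_unique (fun x : R => w x) _ _ Hw).
    replace Delta with (- om ^ 2) by lra.
    assert (0 < w t ^ 2 + om ^ 2) by nra.
    field; split; [lra | nra]. }
  pose proof (atan_bound (w a / om)); pose proof (atan_bound (w b / om)); lra.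
Qed.

Lemma supercritical_horizon (d m a b : R) (w : R -> R) :
  0 <= d -> 0 < m -> a < b -> d + 2 * m < w b ->
  (forall t, a <= t <= b -> is_derive w t ((d ^ 2 - w t ^ 2) / 2)) ->
  (b - a) * m < 2.
Proof.
  intros Hd Hm Hab Hb Hw.
  (* [(w - d - m)^+ ^2] is nonincreasing in [t]: its slope vanishes unless
     [w > d], where [w' < 0]. *)
  assert (Hlow : forall t, a <= t <= b -> d + m < w t).
  { intros t Ht.
    destruct (Rle_lt_or_eq_dec t b) as [Htb | ->]; [lra | | lra].
    assert (H : 0 * (b - t) <=
                - Rmax 0 (w b - d - m) ^ 2 - - Rmax 0 (w t - d - m) ^ 2).
    { apply (derive_lower_bound (fun s => - Rmax 0 (w s - d - m) ^ 2)
               (fun s => - ((d ^ 2 - w s ^ 2) / 2 * (2 * Rmax 0 (w s - d - m)))));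
        [exact Htb | |].
      - intros s Hs.
        apply (is_derive_opp (fun s => Rmax 0 (w s - d - m) ^ 2)).
        apply (is_derive_comp (fun y => Rmax 0 y ^ 2) (fun s => w s - d - m)).
        + apply is_derive_pos_part_sqr.
        + assert (Hws := Hw s ltac:(lra)).
          assert (Hex : ex_derive w s) by (eexists; exact Hws).
          auto_derive; [exact Hex|].
          rewrite (is_derive_unique (fun x : R => w x) _ _ Hws); ring.
      - intros s Hs; unfold Rmax; destruct (Rle_dec 0 (w s - d - m)); [|lra].
        assert (0 <= (w s ^ 2 - d ^ 2) * (w s - d - m)); [|lra].
        apply Rmult_le_pos; nra. }
    (* If [w t <= d + m], the truncated square would be 0 at [t] yet positive at [b], against
       monotonicity. *)
    rewrite (Rmax_right 0 (w b - d - m)) in H by lra.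
    destruct (Rlt_le_dec (d + m) (w t)) as [|Hle]; [assumption|].
    rewrite (Rmax_left 0 (w t - d - m)) in H by lra.
    nra. }
  (* The slope [(w + d) / (2 * (w - d))] is at least 1/2 because [d >= 0]. *)
  assert (H : 1 / 2 * (b - a) <= / (w b - d) - / (w a - d)).
  { apply (derive_lower_bound (fun t => / (w t - d))
             (fun t => (w t + d) / (2 * (w t - d)))); [exact Hab | |].
    - intros t Ht; specialize (Hlow t Ht); specialize (Hw t Ht).
      assert (Hex : ex_derive w t) by (eexists; exact Hw).
      auto_derive; [split; [exact Hex | split; [lra | exact I]]|].
      rewrite (is_derive_unique (fun x : R => w x) _ _ Hw); field; lra.
    - intros t Ht; specialize (Hlow t Ht).
      apply Rmult_le_reg_r with (2 * (w t - d)); [lra|].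
      unfold Rdiv; rewrite (Rmult_assoc (w t + d)), Rinv_l by lra; lra. }
  assert (Ha := Hlow a ltac:(lra)).
  assert (0 < / (w a - d)) by (apply Rinv_0_lt_compat; lra).
  assert (/ (w b - d) < / m) by (apply Rinv_lt_contravar; nra).
  assert (Hlt : (b - a) * / 2 < / m) by lra.
  apply (Rmult_lt_compat_r (2 * m)) in Hlt; [|lra].
  replace (/ m * (2 * m)) with 2 in Hlt by (field; lra).
  lra.
Qed.

(** * Sufficiency: an explicit solution *)

(* [C = cosh (d s)] and [S = sinh (d s) / d], read as [1] and [s] when [d = 0]. *)
Lemma cosh_sinh_pair (d : R) :
  0 <= d ->
  exists C S : R -> R,
    (forall s, is_derive C s (d ^ 2 * S s)) /\
    (forall s, is_derive S s (C s)) /\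
    C 0 = 1 /\ S 0 = 0 /\
    (forall s, 0 <= s -> 0 <= S s /\ 0 < C s - d * S s).
Proof.
  intros Hd; destruct (Rle_lt_or_eq_dec 0 d Hd) as [Hd0 | <-].
  - exists (fun s => (exp (d * s) + exp (- (d * s))) / 2),
      (fun s => (exp (d * s) - exp (- (d * s))) / (2 * d)).
    split; [|split; [|split; [|split]]].
    + intros s; auto_derive; [exact I | field; lra].
    + intros s; auto_derive; [exact I | field; lra].
    + rewrite Rmult_0_r, Ropp_0, exp_0; field.
    + rewrite Rmult_0_r, Ropp_0, exp_0; field; lra.
    + intros s Hs; split.
      * apply Rmult_le_pos.
        -- assert (exp (- (d * s)) <= exp (d * s)); [|lra].
           destruct (Rle_lt_or_eq_dec 0 s Hs) as [|<-].
           ++ apply Rlt_le, exp_increasing; nra.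
           ++ rewrite Rmult_0_r, Ropp_0; lra.
        -- apply Rlt_le, Rinv_0_lt_compat; lra.
      * replace (_ - _) with (exp (- (d * s))) by (field; lra).
        apply exp_pos.
  - exists (fun _ => 1), (fun s => s); split; [|split; [|repeat split; lra]].
    + intros s; auto_derive; [exact I | ring].
    + intros s; auto_derive; [exact I | ring].
Qed.

(** Here [d] is half of [sqrt Delta], so [d ^ 2] is the square of the matrix [M] of the linear
    system. *)
Lemma riccati_solution_exists (alpha beta gamma g d T : R) :
  0 <= d -> 4 * d ^ 2 = alpha ^ 2 - 4 * beta * gamma ->
  2 * beta * g + alpha <= 2 * d ->
  exists p, riccati_solution alpha beta gamma g T p.
Proof.
  intros Hd HD Hw.
  destruct (cosh_sinh_pair d Hd) as (C & S & HC & HS & HC0 & HS0 & Hpos).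
  (* [exp (s M) = C s + S s * M], applied to the initial vector [(g, 1)]. *)
  set (N := fun s => g * C s + (alpha / 2 * g + gamma) * S s).
  set (D := fun s => C s - (beta * g + alpha / 2) * S s).
  assert (HDpos : forall s, 0 <= s -> 0 < D s).
  { intros s Hs; destruct (Hpos s Hs) as [HSs Hlt].
    assert (Hle : beta * g + alpha / 2 <= d) by lra.
    pose proof (Rmult_le_compat_r (S s) _ _ HSs Hle); unfold D; lra. }
  set (p := fun t => N (T - t) / D (T - t)).
  exists p; split.
  - exists (fun t => - (alpha * p t + beta * p t ^ 2 + gamma)).
    intros t Ht; split; [|ring].
    apply is_derive_D_in.
    assert (HDt : 0 < D (T - t)) by (apply HDpos; lra).
    assert (HCx : ex_derive C (T - t)) by (eexists; apply HC).
    assert (HSx : ex_derive S (T - t)) by (eexists; apply HS).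
    unfold p, N, D in *; auto_derive;
      replace (T + - t) with (T - t) by ring; [intuition lra|].
    rewrite (is_derive_unique (fun x : R => C x) _ _ (HC (T - t))).
    rewrite (is_derive_unique (fun x : R => S x) _ _ (HS (T - t))).
    replace (d ^ 2) with (alpha ^ 2 / 4 - beta * gamma) by lra.
    field; lra.
  - unfold p, N, D; rewrite Rminus_diag, HC0, HS0; field.
Qed.

Theorem proposition6p1 (alpha beta gamma g : R) :
  (forall T : R, 0 < T ->
     exists p : R -> R, riccati_solution alpha beta gamma g T p)
  <->
  (alpha ^ 2 - 4 * beta * gamma >= 0 /\
   2 * beta * g + alpha - sqrt (alpha ^ 2 - 4 * beta * gamma) <= 0).
Proof.
  split.
  - intros Hall.
    assert (HD : 0 <= alpha ^ 2 - 4 * beta * gamma).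
    { apply Rnot_lt_le; intros HD.
      set (om := sqrt (- (alpha ^ 2 - 4 * beta * gamma))).
      assert (Hom : 0 < om) by (apply sqrt_lt_R0; lra).
      assert (HL : 0 < 2 * PI / om).
      { pose proof PI_RGT_0; apply Rdiv_lt_0_compat; lra. }
      (* Leaving one unit at each end gives an interior interval of length [2 * PI / om], on which
         the strict bound reads [PI < PI]. *)
      destruct (Hall (2 * PI / om + 2)) as [p Hp]; [lra|].
      assert (H := negative_discriminant_horizon _ 1 (2 * PI / om + 1)
                     (fun t => 2 * beta * p t + alpha) HD ltac:(lra)).
      apply (Rlt_irrefl PI).
      replace PI with (om / 2 * (2 * PI / om + 1 - 1)) at 1 by (field; lra).
      apply H; intros t Ht; apply riccati_normal_form with (1 := Hp); lra. }
    split; [lra|].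
    set (d := sqrt (alpha ^ 2 - 4 * beta * gamma)).
    assert (Hd : 0 <= d) by apply sqrt_pos.
    assert (Hd2 : d ^ 2 = alpha ^ 2 - 4 * beta * gamma) by (apply pow2_sqrt, HD).
    apply Rnot_lt_le; intros Hw.
    (* With a quarter of the excess, [d + 2 * m] is midway between [d] and the terminal value of
       [w]. *)
    set (m := (2 * beta * g + alpha - d) / 4).
    assert (Hm : 0 < m) by (unfold m; lra).
    assert (HL : 0 < 2 / m) by (apply Rdiv_lt_0_compat; lra).
    (* Since [b > T - 1], the interval from [b - 2 / m] to [b] stays interior; its length
       contradicts the strict bound. *)
    destruct (Hall (2 / m + 2)) as [p Hp]; [lra|].
    destruct (riccati_terminal_limit _ _ _ _ _ _ 1 (d + 2 * m) Hp)
      as (b & Hb & Hb1 & Hwb); [lra | lra | unfold m; lra |].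
    assert (H : (b - (b - 2 / m)) * m < 2).
    { apply (supercritical_horizon d m (b - 2 / m) b
               (fun t => 2 * beta * p t + alpha)); try assumption; [lra|].
      intros t Ht; rewrite Hd2; apply riccati_normal_form with (1 := Hp); lra. }
    replace ((b - (b - 2 / m)) * m) with 2 in H by (field; lra).
    lra.
  - intros [HD Hw] T HT.
    pose proof (sqrt_pos (alpha ^ 2 - 4 * beta * gamma)).
    pose proof (pow2_sqrt (alpha ^ 2 - 4 * beta * gamma) ltac:(lra)).
    apply riccati_solution_exists
      with (d := sqrt (alpha ^ 2 - 4 * beta * gamma) / 2); lra.
Qed.
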